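(* Let $M\ge 2$, $N=2M$, and let $\{\beta_k,B_k,L_k\}_{k=1}^N$ be juncture parameters of Type I-OEE, i.e. $$L_{k+M}=L_k,\qquad B_k=\beta_{k+M},\qquad B_{k+M}=\beta_k\qquad (k=1,\dots,M),$$ satisfying the continuity constraint $\sum_{k=1}^{N}L_k\cos\beta_k=0=\sum_{k=1}^{N}L_k\cos B_k$ (equivalently $\sum_{k=1}^M L_k(\cos\beta_k+\cos\beta_{k+M})=0$). Then the prismatic juncture with these parameters is flexible.
   Context: Juncture parameters: for an even integer $N\ge 4$, real numbers $L_k>0$ (edge lengths) and $\beta_k,B_k\in(0,\pi)$ (face angles), $k=1,\dots,N$; the index $k$ is cyclic mod $N$. For an angle $\theta\in(0,\pi/2)$ let $\mathbf u(\theta)=(-\sin\theta,-\cos\theta,0)$ and $\mathbf w(\theta)=(\sin\theta,-\cos\theta,0)$. A prismatic juncture at $\theta$ with the given parameters is a closed polygon $\mathbf v_1,\dots,\mathbf v_N\in\mathbb R^3$ ($\mathbf v_{N+1}=\mathbf v_1$) with, for every $k=1,\dots,N$, $$|\mathbf v_{k+1}-\mathbf v_k|=L_k,\quad (\mathbf v_{k+1}-\mathbf v_k)\cdot\mathbf u(\theta)=L_k\cos\beta_k,\quad (\mathbf v_{k+1}-\mathbf v_k)\cdot\mathbf w(\theta)=L_k\cos B_k .$$ Geometrically, two unbounded annular tubes meet along this polygon: one made of the half-strips $\{\mathbf p+s\mathbf u:\mathbf p\in[\mathbf v_k,\mathbf v_{k+1}],\ s\ge0\}$, the other of the half-strips $\{\mathbf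 p+s\mathbf w:\mathbf p\in[\mathbf v_k,\mathbf v_{k+1}],\ s\ge0\}$; $\beta_k$ and $B_k$ are the face angles at $\mathbf v_k$. Self-intersections are allowed. The juncture with given parameters is flexible, with $\theta$ as the variable of flexion, if there are an interval $I\subset(0,\pi/2)$ of positive length and continuous maps $\mathbf v_1,\dots,\mathbf v_N:I\to\mathbb R^3$ such that for every $\theta\in I$ the points $\mathbf v_1(\theta),\dots,\mathbf v_N(\theta)$ form a prismatic juncture at $\theta$ with these fixed parameters.
   Formalization: Adds the assumption that at some common angle θ in (0, π/2) each edge, taken individually, can be placed in space with its two half-strips not coplanar; without it there may be no juncture with the given parameters, and every flexible juncture satisfies it. *)

(* Defs.v *)
From mathcomp Require Import all_boot all_order all_algebra.
From mathcomp Require Import all_classical all_reals all_analysis.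

Set Implicit Arguments.
Unset Strict Implicit.
Unset Printing Implicit Defensive.

Import Order.TTheory GRing.Theory Num.Theory.
Import numFieldNormedType.Exports.

Local Open Scope classical_set_scope.
Local Open Scope ring_scope.

Section Junctures.
Variable R : realType.

(* The library norm on 'rV[R]_3 is the sup norm, hence an explicit Euclidean
   one; the topology used for continuity below is the same for both. *)
Definition dot (x y : 'rV[R]_3) : R := \sum_i x 0 i * y 0 i.
Definition enorm (x : 'rV[R]_3) : R := Num.sqrt (dot x x).

Definition dir_u (theta : R) : 'rV[R]_3 :=
  \row_i [:: - sin theta; - cos theta; 0]`_i.
Definition dir_w (theta : R) : 'rV[R]_3 :=
  \row_i [:: sin theta; - cos theta; 0]`_i.

(* Cyclic indices 1..N are represented by 'I_N, with [ordS] for k |-> k+1. *)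
Definition juncture_params (N : nat) (L beta B : 'I_N -> R) : Prop :=
  forall k, [/\ 0 < L k, 0 < beta k < pi & 0 < B k < pi].

Definition is_edge (theta l b b' : R) (e : 'rV[R]_3) : Prop :=
  [/\ enorm e = l,
      dot e (dir_u theta) = l * cos b &
      dot e (dir_w theta) = l * cos b'].

Definition prismatic_juncture (N : nat) (L beta B : 'I_N -> R) (theta : R)
    (v : 'I_N -> 'rV[R]_3) : Prop :=
  forall k, is_edge theta (L k) (beta k) (B k) (v (ordS k) - v k).

Definition flexible (N : nat) (L beta B : 'I_N -> R) : Prop :=
  exists (I : set R) (v : 'I_N -> R -> 'rV[R]_3),
    [/\ is_interval I,
        exists a b, [/\ I a, I b & a < b],
        I `<=` `]0, pi / 2[,
        forall k, {within I, continuous (v k)} &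
        forall theta, I theta ->
          prismatic_juncture L beta B theta (fun k => v k theta)].

(* The indices k and k + M (1 <= k <= M) are [lshift M k] and [rshift M k]. *)
Definition typeI_OEE (M : nat) (L beta B : 'I_(M + M) -> R) : Prop :=
  forall k : 'I_M,
    [/\ L (rshift M k) = L (lshift M k),
        B (lshift M k) = beta (rshift M k) &
        B (rshift M k) = beta (lshift M k)].

Definition continuity_constraint (N : nat) (L beta B : 'I_N -> R) : Prop :=
  \sum_k L k * cos (beta k) = 0 /\ \sum_k L k * cos (B k) = 0.

(* At some common theta every single edge can be placed in space so that its
   two half-strips are not coplanar, i.e. the edge does not lie in the plane
   z = 0 spanned by u and w. The edges are not required to close up. Without
   this condition there need not be any juncture with the given parameters, or
   there may be one at a single value of theta only; it holds whenever there
   is a juncture none of whose edges is parallel to that plane. *)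
Definition edges_placeable (N : nat) (L beta B : 'I_N -> R) : Prop :=
  exists theta : R, 0 < theta < pi / 2 /\
    forall k, exists e : 'rV[R]_3,
      is_edge theta (L k) (beta k) (B k) e /\ e 0 (inord 2) != 0.

End Junctures.

(* Main.v *)
(** In the coordinates of the directions [u] and [w], an edge at [theta] has its
    [x] and [y] components determined by its parameters, and [z] determined up
    to sign. Under the symmetry of Type I-OEE the edges [k] and [k + M] have
    opposite [x], equal [y] and equal [z ^ 2]; taking opposite signs for [z], the
    [x] and [z] components cancel in pairs, and the [y] components sum to zero by
    the continuity constraint. So the polygon closes at every [theta] for which
    all the [z ^ 2] are nonnegative, and being positive is an open condition. *)
Require Import Defs.
From mathcomp Require Import all_boot all_order all_algebra.
From mathcomp Require Import all_classical all_reals all_analysis.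
From mathcomp Require Import ring lra.

Set Implicit Arguments.
Unset Strict Implicit.
Unset Printing Implicit Defensive.

Import Order.TTheory GRing.Theory Num.Theory.
Import numFieldNormedType.Exports.

Local Open Scope classical_set_scope.
Local Open Scope ring_scope.

Section Edges.
Variable R : realType.
Implicit Types (theta l b s x y z : R) (e : 'rV[R]_3).

Definition vec3 x y z : 'rV[R]_3 := \row_i [:: x; y; z]`_i.

(** Half the difference and half the sum of the two dot-product equations isolate [x * sin theta]
    and [- y * cos theta]; the length then leaves [edge_z2] for the square of [z]. *)
Definition edge_x l b b' theta : R := l * (cos b' - cos b) / (2 * sin theta).
Definition edge_y l b b' theta : R := - (l * (cos b + cos b')) / (2 * cos theta).
Definition edge_z2 l b b' theta : R :=
  l ^+ 2 - edge_x l b b' theta ^+ 2 - edge_y l b b' theta ^+ 2.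

(** The factor [s] is the free sign of [z]. Where [edge_z2] is negative the root is 0 by convention,
    so the formula is total but need not give an edge. *)
Definition edge s l b b' theta : 'rV[R]_3 :=
  vec3 (edge_x l b b' theta) (edge_y l b b' theta)
       (s * Num.sqrt (edge_z2 l b b' theta)).

Lemma vec3_eta e : e = vec3 (e 0 0) (e 0 (inord 1)) (e 0 (inord 2)).
Proof.
apply/rowP => i; rewrite mxE.
by case: i => [[|[|[|]]] //] p /=; congr (e 0 _); apply/val_inj; rewrite /= ?inordK.
Qed.

Lemma dot_vec3 x y z x' y' z' :
  dot (vec3 x y z) (vec3 x' y' z') = x * x' + y * y' + z * z'.
Proof. by rewrite /dot !big_ord_recl big_ord0 !mxE /= addr0 addrA. Qed.

Lemma vec3D x y z x' y' z' :
  vec3 x y z + vec3 x' y' z' = vec3 (x + x') (y + y') (z + z').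
Proof. by apply/rowP => -[[|[|[|]]] //] p; rewrite !mxE. Qed.

Lemma is_edge_vec3 theta l b b' x y z : 0 < l -> sin theta != 0 -> cos theta != 0 ->
  is_edge theta l b b' (vec3 x y z) <->
  [/\ x = edge_x l b b' theta, y = edge_y l b b' theta &
      z ^+ 2 = edge_z2 l b b' theta].
Proof.
move=> l0 s0 c0; rewrite /is_edge /enorm /dir_u /dir_w !dot_vec3.
have nE : (Num.sqrt (x * x + y * y + z * z) = l) <-> (x ^+ 2 + y ^+ 2 + z ^+ 2 = l ^+ 2).
  rewrite -!expr2; split=> [<-|->]; last by rewrite sqrtr_sqr gtr0_norm.
  by rewrite sqr_sqrtr // !addr_ge0 ?sqr_ge0.
have xE : (x = edge_x l b b' theta) <-> (2 * x * sin theta = l * cos b' - l * cos b).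
  by split=> [->|h]; rewrite /edge_x; [field | apply: (mulIf s0); field: h].
have yE : (y = edge_y l b b' theta) <-> (2 * y * cos theta = - (l * cos b' + l * cos b)).
  by split=> [->|h]; rewrite /edge_y; [field | apply: (mulIf c0); field: h].
rewrite !mulr0 !addr0; split=> [[/nE n u w]|[ex ey ez]].
  have ex : x = edge_x l b b' theta by apply/xE; lra.
  have ey : y = edge_y l b b' theta by apply/yE; lra.
  by split=> //; rewrite /edge_z2 -ex -ey -n; ring.
move/xE: (ex) => hx; move/yE: (ey) => hy; split; [apply/nE|lra|lra].
by rewrite ez /edge_z2 -ex -ey; ring.
Qed.

Lemma is_edge_edge s theta l b b' : 0 < l -> sin theta != 0 -> cos theta != 0 ->
  s ^+ 2 = 1 -> 0 <= edge_z2 l b b' theta ->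
  is_edge theta l b b' (edge s l b b' theta).
Proof.
move=> l0 s0 c0 s1 z0; apply/is_edge_vec3 => //; split=> //.
by rewrite exprMn s1 mul1r sqr_sqrtr.
Qed.

(** Turns the placement of an edge off the plane [z = 0] into a strict inequality, which persists
    for nearby angles. *)
Lemma edge_z2_gt0 theta l b b' e : 0 < l -> sin theta != 0 -> cos theta != 0 ->
  is_edge theta l b b' e -> e 0 (inord 2) != 0 -> 0 < edge_z2 l b b' theta.
Proof.
move=> l0 s0 c0; rewrite {1}(vec3_eta e) => /is_edge_vec3[] // _ _ <- z0.
by rewrite exprn_even_gt0.
Qed.

(** Swapping [b] and [b'] negates [edge_x] and fixes [edge_y], hence fixes [edge_z2]. The
    cancellation is formal and needs no sign of [edge_z2]. *)
Lemma edge_pair theta l b b' :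
  edge 1 l b b' theta + edge (-1) l b' b theta =
  vec3 0 (2 * edge_y l b b' theta) 0.
Proof.
have xN : edge_x l b' b theta = - edge_x l b b' theta.
  by rewrite /edge_x -mulNr -mulrN opprB.
have yN : edge_y l b' b theta = edge_y l b b' theta.
  by rewrite /edge_y [cos b' + _]addrC.
by rewrite /edge vec3D /edge_z2 xN yN sqrrN; congr vec3; ring.
Qed.

Lemma edge_x_cvg theta l b b' : sin theta != 0 ->
  edge_x l b b' t @[t --> theta] --> edge_x l b b' theta.
Proof.
move=> s0; apply: cvgMl_tmp; apply: cvgV; first by rewrite mulf_neq0 // pnatr_eq0.
by apply: cvgMl_tmp; exact: continuous_sin.
Qed.

Lemma edge_y_cvg theta l b b' : cos theta != 0 ->
  edge_y l b b' t @[t --> theta] --> edge_y l b b' theta.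
Proof.
move=> c0; apply: cvgMl_tmp; apply: cvgV; first by rewrite mulf_neq0 // pnatr_eq0.
by apply: cvgMl_tmp; exact: continuous_cos.
Qed.

Lemma edge_z2_cvg theta l b b' : sin theta != 0 -> cos theta != 0 ->
  edge_z2 l b b' t @[t --> theta] --> edge_z2 l b b' theta.
Proof.
move=> s0 c0; apply: cvgB; first apply: cvgB; first exact: cvg_cst.
- by apply: cvgM; exact: edge_x_cvg.
- by apply: cvgM; exact: edge_y_cvg.
Qed.

Lemma edge_cvg s theta l b b' : sin theta != 0 -> cos theta != 0 ->
  edge s l b b' t @[t --> theta] --> edge s l b b' theta.
Proof.
move=> s0 c0.
(* Expanding in a fixed basis reduces the limit to the three scalar coordinates. *)
have vec3E x y z : vec3 x y z = x *: vec3 1 0 0 + y *: vec3 0 1 0 + z *: vec3 0 0 1.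
  by apply/rowP => -[[|[|[|]]] //] p; rewrite !mxE /=; ring.
rewrite /edge vec3E; under eq_fun do rewrite vec3E.
apply: cvgD; first apply: cvgD; apply: cvgZr_tmp.
- exact: edge_x_cvg.
- exact: edge_y_cvg.
- apply: cvgMl_tmp; apply: continuous_cvg; first exact: sqrt_continuous.
  exact: edge_z2_cvg.
Qed.

End Edges.

(** With partial sums as vertices, consecutive differences telescope; only the step from the last
    vertex back to the first uses that the total is zero. *)
Lemma closed_polygon (V : zmodType) (N : nat) (e : 'I_N -> V) :
  \sum_k e k = 0 ->
  forall k, \sum_(j < N | (j < ordS k)%N) e j - \sum_(j < N | (j < k)%N) e j = e k.
Proof.
case: N e => [e _ [] //|N e e0 k].
have sumS : \sum_(j < N.+1 | (j < k.+1)%N) e j = e k + \sum_(j < N.+1 | (j < k)%N) e j.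
  rewrite (bigD1 k) //=; congr (_ + _); apply: eq_bigl => j.
  by rewrite ltnS [RHS]ltn_neqAle andbC.
suff -> : \sum_(j < N.+1 | (j < ordS k)%N) e j = \sum_(j < N.+1 | (j < k.+1)%N) e j.
  by rewrite sumS addrK.
have [kN|kN] := ltnP k.+1 N.+1; first by apply: eq_bigl => j; rewrite /= modn_small.
have kE : k.+1 = N.+1 by apply/eqP; rewrite eqn_leq kN ltn_ord.
(* Here [ordS k] wraps to 0: the empty sum agrees with the full sum because both vanish. *)
rewrite big_pred0 => [|j]; last by rewrite /= kE modnn.
by rewrite -[LHS]e0; apply: eq_bigl => j; rewrite kE ltn_ord.
Qed.

Theorem theoremI (R : realType) (M : nat) (L beta B : 'I_(M + M) -> R) :
  (2 <= M)%N ->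
  juncture_params L beta B ->
  typeI_OEE L beta B ->
  continuity_constraint L beta B ->
  edges_placeable L beta B ->
  flexible L beta B.
Proof.
move=> _ params oee [sum_beta _] [theta0 [theta0P placeable]].
have L0 k : 0 < L k by case: (params k).
have sin0 (t : R) : 0 < t < pi / 2 -> sin t != 0.
  move=> /andP[t0 tpi]; rewrite gt_eqF // sin_gt0_pihalf // t0.
  exact: tpi.
have cos0 (t : R) : 0 < t < pi / 2 -> cos t != 0.
  move=> /andP[t0 tpi]; rewrite gt_eqF // cos_gt0_pihalf // tpi andbT.
  by apply: lt_trans t0; rewrite oppr_lt0 divr_gt0 ?pi_gt0.
pose z2 k := edge_z2 (L k) (beta k) (B k).
have [r r0 rP] : exists2 r : R, 0 < r &
    forall t, `|theta0 - t| < r -> 0 < t < pi / 2 /\ forall k, 0 < z2 k t.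
  have near_pihalf : \forall t \near theta0, 0 < t < pi / 2.
    have : theta0 \in `]0, pi / 2[ by rewrite in_itv.
    by move=> /near_in_itvoo; apply: filterS => t; rewrite in_itv.
  have near_z2 : \forall t \near theta0, forall k, 0 < z2 k t.
    (* There are finitely many edges, so their neighbourhoods of [theta0] have a common one. *)
    apply: (@filter_forall R 'I_(M + M) (fun k t => 0 < z2 k t) (nbhs theta0)) => k.
    have [e [eP e_z]] := placeable k.
    have z0 : 0 < z2 k theta0 by apply: edge_z2_gt0 eP e_z; rewrite ?sin0 ?cos0.
    have : z2 k t @[t --> theta0] --> z2 k theta0.
      by apply: edge_z2_cvg; [exact: sin0 | exact: cos0].
    by move/cvgr_gt; apply.
  have : \forall t \near theta0, 0 < t < pi / 2 /\ forall k, 0 < z2 k t.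
    exact: filterI near_pihalf near_z2.
  by move=> /nbhs_ballP[r r0 rP]; exists r.
pose sg (k : 'I_(M + M)) : R := if (k < M)%N then 1 else -1.
pose e k t := edge (sg k) (L k) (beta k) (B k) t.
have e_sum t : \sum_k e k t = 0.
  have -> : \sum_k e k t =
      \sum_(k < M) vec3 0 (2 * edge_y (L (lshift M k)) (beta (lshift M k)) (B (lshift M k)) t) 0.
    rewrite big_split_ord /= -big_split; apply: eq_bigr => k _.
    have [LE BlE BrE] := oee k.
    by rewrite /= -edge_pair /e /sg /= ltn_ord ltnNge leq_addr LE BrE BlE.
  apply/rowP => i; rewrite summxE mxE.
  case: i => [[|[|[|]]] //] p.
  - by rewrite big1 // => k _; rewrite mxE.
  - under eq_bigr => k _ do rewrite mxE /= /edge_y.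
    (* Since [B k] is the [beta] of the partner edge, the paired [y] components collect the
       constraint sum over all edges, times a factor depending on [t] alone. *)
    transitivity ((\sum_k L k * cos (beta k)) * (- 2 / (2 * cos t))); last first.
      by rewrite sum_beta mul0r.
    rewrite big_split_ord /= -big_split mulr_suml /=.
    apply: eq_bigr => k _; have [LE BlE BrE] := oee k.
    by rewrite LE BlE; ring.
  - by rewrite big1 // => k _; rewrite mxE.
(* The vertices are the partial sums of the edges, so vertex 0 stays at the origin throughout the
   flexion. *)
exists `]theta0 - r, theta0 + r[%classic, (fun k t => \sum_(j < M + M | (j < k)%N) e j t).
have IP t : `]theta0 - r, theta0 + r[%classic t -> `|theta0 - t| < r.
  by rewrite /= in_itv /= ltr_distlC.
split.
- exact: interval_is_interval.
- exists (theta0 - r / 2), (theta0 + r / 2); rewrite /= !in_itv /=.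
  by split; lra.
- by move=> t /IP /rP[]; rewrite /= in_itv.
- move=> k; apply: continuous_in_subspaceT => t /set_mem /IP /rP[tP _].
  apply: cvg_big => [|j _]; first exact: add_continuous.
  apply: edge_cvg; [exact: sin0 | exact: cos0].
- move=> t /IP /rP[tP z0] k; rewrite closed_polygon //.
  apply: is_edge_edge => //; [exact: sin0|exact: cos0| |exact/ltW/z0].
  by rewrite /sg; case: ifP => _; rewrite ?sqrrN expr1n.
Qed.
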